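(* Let $X$ be a compact canonical Skula space, with canonical clopen selector $\{U_x:x\in X\}$ and induced order. Then its hyperspace $H(X)$ is canonically Skula. Moreover, the Cantor–Bendixson height in $H(X)$ of any member of $H(X)$ can be calculated by the following rules. Every member of $H(X)$ is of the form $U_\sigma=\bigcup_{x\in\sigma}U_x$ for a nonempty finite antichain $\sigma$ of $X$, and $$\mathrm{ht}_{H(X)}(U_\sigma)=\bigoplus_{x\in\sigma}\mathrm{ht}_{H(X)}(U_x),$$ where for $x\in X$: $\mathrm{ht}_{H(X)}(U_x)=0$ if $\mathrm{ht}_X(x)=0$; $\mathrm{ht}_{H(X)}(U_x)=1$ if $\mathrm{ht}_X(x)=1$; and $\mathrm{ht}_{H(X)}(U_x)=\omega^{\alpha}$ if $\mathrm{ht}_X(x)=1+\alpha\ge 2$.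
   Context: A clopen selector for a space $X$ is a family $\{U_x : x\in X\}$ of clopen subsets of $X$ such that: (1) $x\in U_x$ for every $x$; (2) for distinct $x,y$, either $x\notin U_y$ or $y\notin U_x$; (3) if $y\in U_x$ then $U_y\subseteq U_x$. It induces the partial order $x\le y$ iff $U_x\subseteq U_y$, with $U_x=\{y:y\le x\}$. A compact Hausdorff space is Skula iff it admits a clopen selector; such spaces are scattered. Cantor–Bendixson height: $X^{[0]}=X$, and for $\alpha>0$, $X^{[\alpha]}=\bigcap_{\beta<\alpha}(X^{[\beta]})^{[1]}$, where $A^{[1]}$ is the set of non-isolated points of the subspace $A$. For scattered $X$, $\mathrm{ht}_X(x)=\alpha$ iff $x\in X^{[\alpha]}\setminus X^{[\alpha+1]}$, and $\mathrm{ht}(X)=\sup_{x}\mathrm{ht}_X(x)$. $X$ is unitary if $X^{[\mathrm{ht}(X)]}$ is a singleton, whose element is denoted $\mathrm{endpt}(X)$. $X$ is canonical Skula (canonically Skula) if it has a canonical clopen selector: a clopen selector $\{U_x:x\in X\}$ such that every subspace $U_x$ is unitary with $\mathrm{endpt}(U_x)=x$. The hyperspace $H(X)$ is the set of nonempty closed initial (downward closed) subsets of $(X,\le)$, ordered by inclusion, with the topology generated by the sets $U^+=\{K\in H(X):K\subseteq U\}$ and $V^-=\{K\in H(X):K\cap V\neq\emptyset\}$ for $U$ clopen initial and $V$ clopen final (upward closed). An antichain is a set of pairwise incomparable elements. $\oplus$ is Hessenberg's natural sum of ordinals (coefficientwise addition of Cantor normal forms). *)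

(* Defs.v *)
From Stdlib Require Sorted.
From HB Require Import structures.
From mathcomp Require Import all_boot all_order finmap.
From mathcomp Require Import boolp classical_sets functions cardinality.
From mathcomp Require Import topology.

Set Implicit Arguments.
Unset Strict Implicit.
Unset Printing Implicit Defensive.

Local Open Scope classical_set_scope.

(** Ordinals are represented by well-founded trees: [OSup f] denotes the least
    ordinal strictly greater than all the [f i].  Distinct trees may represent
    the same ordinal, so that equality of ordinals is [=o], not [=]. *)
Inductive ord := OSup (I : Type) (f : I -> ord).

Definition oidx (a : ord) : Type := let: OSup A _ := a in A.
Definition ochild (a : ord) : oidx a -> ord :=
  match a return oidx a -> ord with OSup _ f => f end.

Fixpoint ole (a b : ord) : Prop :=
  match a, b with OSup A f, OSup B g => forall i, exists j, ole (f i) (g j) end.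

Definition olt (a b : ord) : Prop := exists j : oidx b, ole a (ochild j).
Definition oeq (a b : ord) : Prop := ole a b /\ ole b a.

Notation "a <=o b" := (ole a b) (at level 70, no associativity).
Notation "a <o b" := (olt a b) (at level 70, no associativity).
Notation "a =o b" := (oeq a b) (at level 70, no associativity).

Definition ozero : ord := OSup (fun i : void => match i with end).
Definition osucc (a : ord) : ord := OSup (fun _ : unit => a).
Definition onat (n : nat) : ord := iter n osucc ozero.
Definition oone : ord := onat 1.
Definition oomega : ord := OSup onat.

(** Least upper bound: the children of [olub f] are all those of the [f i]. *)
Definition olub (I : Type) (f : I -> ord) : ord :=
  OSup (fun p : {i : I & oidx (f i)} => ochild (projT2 p)).
Definition omax (a b : ord) : ord := olub (fun c : bool => if c then a else b).

(** [a + b = max (a, sup_(c < b) (a + c + 1))] *)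
Fixpoint oadd (a b : ord) : ord :=
  match b with OSup B g => omax a (OSup (fun j => oadd a (g j))) end.

(** [a * b = sup_(c < b) (a * c + a)] *)
Fixpoint omul (a b : ord) : ord :=
  match b with OSup B g => olub (fun j => oadd (omul a (g j)) a) end.

(** [omega ^ b = max (1, sup_(c < b) (omega ^ c * omega))] *)
Fixpoint oexpw (b : ord) : ord :=
  match b with
  | OSup B g => omax oone (olub (fun j => omul (oexpw (g j)) oomega))
  end.

(** Some ordinal satisfying [P], and [0] if there is none. *)
Definition othe (P : ord -> Prop) : ord :=
  match pselect (exists a, P a) with
  | left h => projT1 (cid h)
  | right _ => ozero
  end.

(** [ocnf [:: (e_1, n_1); ...; (e_k, n_k)]] is
    [omega ^ e_1 * n_1 + ... + omega ^ e_k * n_k]. *)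
Definition ocnf (t : seq (ord * nat)) : ord :=
  foldr (fun p c => oadd (omul (oexpw p.1) (onat p.2)) c) ozero t.

(** Coefficientwise addition of Cantor normal forms: [t] lists, for strictly
    decreasing exponents, the coefficients of [a] and of [b].  Zero coefficients
    are allowed, so that both normal forms can be written with the same
    exponents. *)
Definition is_hsum (a b c : ord) : Prop :=
  exists t : seq (ord * (nat * nat)),
    [/\ Sorted.Sorted (fun p q => q.1 <o p.1) t,
        a =o ocnf [seq (p.1, p.2.1) | p <- t],
        b =o ocnf [seq (p.1, p.2.2) | p <- t] &
        c =o ocnf [seq (p.1, (p.2.1 + p.2.2)%N) | p <- t]].

Definition hsum (a b : ord) : ord := othe (is_hsum a b).

Section CantorBendixson.
Variable X : topologicalType.
Implicit Types (A : set X) (x : X).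

Definition cbderiv A : set X := A `\` isolated A.

(** The iterated derivative of the subspace [A]; it is computed inside [X], which
    is harmless since being isolated in [B `<=` A] only depends on the topology
    induced on [B].  The intersection ranges over the children of the tree only;
    [cbP] below shows that it is the one over all smaller ordinals. *)
Fixpoint cb A (a : ord) : set X :=
  match a with OSup _ f => [set x | A x /\ forall i, cbderiv (cb A (f i)) x] end.

Definition is_height A x (a : ord) : Prop := (cb A a `\` cb A (osucc a)) x.

(** Any [x] in a scattered [A] has a height, unique up to [=o]; the default value
    of [othe] is irrelevant then.  A space with a canonical selector is scattered:
    some iterated derivative of the open set [U_x] is [[set x]], the next is empty. *)
Definition height A x : ord := othe (is_height A x).

Definition set_height A : ord := olub (fun x : {x : X | A x} => height A (sval x)).

(** [A] is unitary and [x] is its end point. *)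
Definition unitary_at A x : Prop := cb A (set_height A) = [set x].

Lemma cb_le A a b : a <=o b -> cb A b `<=` cb A a.
Proof.
elim: a b => I f IH [J g] /= le_ab x [Ax xb]; split=> // i.
have [j le_ij] := le_ab i; have [xj nisoj] := xb j.
split; first exact: IH le_ij _ xj.
move=> [_ [V Vx Vf]]; apply: nisoj; split; first by rewrite inE.
exists V => //; apply/seteqP; split=> [y [Vy yj]|y ->].
  by rewrite -Vf; split=> //; exact: IH le_ij _ yj.
by split=> //; exact: nbhs_singleton.
Qed.

Lemma ole_refl a : a <=o a.
Proof. by elim: a => I f IH /= i; exists i. Qed.

Lemma cbP A a x : cb A a x <-> A x /\ forall b, b <o a -> cbderiv (cb A b) x.
Proof.
case: a => I f; split=> [/= [Ax xf]|[Ax xf]].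
  split=> // b [i /= le_bi].
  have [] : cb A (osucc b) x; last by move=> _ /(_ tt).
  by apply: (@cb_le A _ (OSup f)) => //= _; exists i.
by split=> // i; apply: xf; exists i; exact: ole_refl.
Qed.

End CantorBendixson.

Record clopen_selector (X : topologicalType) := ClopenSelector {
  selector :> X -> set X;
  selector_clopen : forall x, clopen (selector x);
  selector_refl : forall x, selector x x;
  selector_anti : forall x y, x <> y -> ~ selector y x \/ ~ selector x y;
  selector_sub : forall x y, selector x y -> selector y `<=` selector x
}.

Definition canonical_selector (X : topologicalType) (U : clopen_selector X) :=
  forall x, unitary_at (U x) x.

Definition canonical_Skula (X : topologicalType) : Prop :=
  [/\ compact [set: X], hausdorff_space X &
      exists U : clopen_selector X, canonical_selector U].

Section Order.
Variables (X : topologicalType) (U : clopen_selector X).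

Definition sle (x y : X) : Prop := U x `<=` U y.

Definition initial (A : set X) : Prop := forall x y, sle x y -> A y -> A x.
Definition final (A : set X) : Prop := forall x y, sle x y -> A x -> A y.

Definition antichain (s : {fset X}) : Prop :=
  forall x y, x \in s -> y \in s -> x <> y -> ~ sle x y /\ ~ sle y x.

Record hyperspace := Hyperspace {
  hset :> set X;
  hset_neq0 : hset !=set0;
  hset_closed : closed hset;
  hset_initial : initial hset
}.

HB.instance Definition _ := gen_eqMixin hyperspace.
HB.instance Definition _ := gen_choiceMixin hyperspace.

Definition hplus (A : set X) : set hyperspace := [set K | K `<=` A].
Definition hminus (A : set X) : set hyperspace := [set K | (K : set X) `&` A !=set0].

Definition hsubbase : set (set hyperspace) :=
  [set hplus A | A in [set A | clopen A /\ initial A]] `|`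
  [set hminus A | A in [set A | clopen A /\ final A]].

HB.instance Definition _ :=
  isSubBaseTopological.Build hyperspace hsubbase id.

Lemma sle_selector x y : sle x y -> U y x.
Proof. by apply; exact: selector_refl. Qed.

Lemma initial_selector x : initial (U x).
Proof. by move=> y z yz xz; apply: (selector_sub xz); exact: sle_selector. Qed.

Definition principal (x : X) : hyperspace :=
  @Hyperspace (U x) (ex_intro _ x (selector_refl U x))
    (selector_clopen U x).2 (@initial_selector x).

Definition Uset (s : {fset X}) : set X := \bigcup_(x in [set` s]) U x.

Lemma Uset_neq0 s : s != fset0 -> Uset s !=set0.
Proof. by case/fset0Pn => x xs; exists x, x => //; exact: selector_refl. Qed.

Lemma Uset_closed s : closed (Uset s).
Proof.
by apply: closed_bigcup => [|x _]; [exact: finite_fset|exact: (selector_clopen U x).2].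
Qed.

Lemma Uset_initial s : initial (Uset s).
Proof. by move=> y z yz [x xs xz]; exists x => //; exact: initial_selector yz xz. Qed.

Definition Uhyper (s : {fset X}) (s0 : s != fset0) : hyperspace :=
  Hyperspace (Uset_neq0 s0) (@Uset_closed s) (@Uset_initial s).

End Order.

(* Main.v *)
Require Import Defs.
From mathcomp Require Import all_boot all_order finmap.
From mathcomp Require Import boolp classical_sets functions cardinality.
From mathcomp Require Import topology.
From Stdlib Require Setoid Morphisms.
Import Corelib.Classes.RelationClasses (Equivalence).
Import Corelib.Classes.Morphisms (Proper, respectful).

(** The height in [H(X)] of an element [K] is computed by guessing it.  The element
    [K] is the union of the sets [U x] for [x] in the finite antichain of its maximal
    points ([hyper_Uset]).  Let [rho K] be the natural sum of the weights [wt] of the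
    heights of these points, where the weight of [a] is the least ordinal above all
    finite natural multiples of the weights of smaller ordinals.

    A function to the ordinals gives the heights of a space as soon as each point has
    a larger value than the other points near it, and is approached by points whose
    value is at least any given smaller ordinal ([is_rank], [height_rank]).  The map
    [rho] has both properties.  It decreases strictly when [K] loses a maximal point [x]
    of positive height, because this point can only be replaced by finitely many
    lower points, whose weights add up to less than the weight of [x] ([rho_lt]).  It
    takes large values near [K] because a natural sum is approached by decreasing one
    of its terms, here the weight of some [x], and an ordinal below this weight is at
    most a multiple of the weight of some [e] smaller than the height of [x]; points of
    height [e] accumulate at [x], and a few of them can replace it ([rho_cof]).

    The first property also shows which clopen selector is canonical.  Maximal points
    of height 0 have weight 0 and losing them does not decrease [rho]; so the set
    attached to [K] consists of the elements contained in [K] that keep these points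
    ([hsel]).  The hyperspace is compact and Hausdorff by the usual arguments for
    the Vietoris topology.

    The arithmetic is done with the natural sum [nsum] defined by well-founded
    recursion, in which the two properties of sums used above are immediate.  It
    agrees with the definition by Cantor normal forms ([hsumE]), and
    the weight of [1 + a] turns out to be [omega] to the power [a] ([wt_oexpw]).  Both
    facts rest on the same lemma: for an ordinal [q] closed under natural sums, adding
    to a multiple of [q] an ordinal at most [q] is a natural sum ([nmul_oadd]). *)

Local Open Scope classical_set_scope.

Set Implicit Arguments.
Unset Strict Implicit.
Unset Printing Implicit Defensive.

(** * Order of tree ordinals *)

Lemma ole_trans b a c : a <=o b -> b <=o c -> a <=o c.
Proof.
elim: a b c => I f IH [J g] [K h] /= ab bc i.
by have [j ij] := ab i; have [k jk] := bc j; exists k; exact: IH ij jk.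
Qed.

Lemma olt_child a (i : oidx a) : ochild i <o a.
Proof. by exists i; exact: ole_refl. Qed.

Lemma ole_lt_trans b a c : a <=o b -> b <o c -> a <o c.
Proof. by move=> ab [k bk]; exists k; exact: ole_trans ab bk. Qed.

Lemma olt_le_trans b a c : a <o b -> b <=o c -> a <o c.
Proof.
case: b c => J g [K h] [j /= aj] /= /(_ j)[k jk].
by exists k; exact: ole_trans aj jk.
Qed.

Lemma oleP a b : a <=o b <-> forall c, c <o a -> c <o b.
Proof.
split=> [ab c ca|]; first exact: olt_le_trans ca ab.
by case: a b => I f [J g] /= ab i; apply: (ab (f i)); exact: (@olt_child (OSup f)).
Qed.

Lemma ole_child a b : (forall i : oidx a, ochild i <o b) -> a <=o b.
Proof. by case: a b => I f [J g]. Qed.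

Lemma oltW {a b} : a <o b -> a <=o b.
Proof.
elim: a b => I f IH b [j ij]; apply: ole_child => i.
by exists j; apply: IH; exact: olt_le_trans (@olt_child (OSup f) i) ij.
Qed.

Lemma olt_trans b a c : a <o b -> b <o c -> a <o c.
Proof. by move=> /oltW; exact: ole_lt_trans. Qed.

(** Trees are only compared classically: this is the excluded middle at each child. *)
Lemma ole_total a b : a <=o b \/ b <o a.
Proof.
elim: a b => I f IH b; have [[i bi]|nb] := pselect (exists i, b <=o f i).
  by right; exists i.
left; apply: ole_child => i /=; apply: contrapT => nfb; apply: nb; exists i.
apply: ole_child => j; have [fj|//] := IH i (ochild j).
by case: nfb; exists j.
Qed.

Lemma olt_ind (P : ord -> Prop) :
  (forall a, (forall b, b <o a -> P b) -> P a) -> forall a, P a.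
Proof.
move=> IHP a; suff : forall b, b <=o a -> P b by apply; exact: ole_refl.
elim: a => I f IH b ba; apply: IHP => c cb.
by have [i ci] := olt_le_trans cb ba; exact: IH ci.
Qed.

Lemma olt_irrefl a : ~ a <o a.
Proof. by elim/olt_ind: a => a IH aa; exact: (IH _ aa). Qed.

Lemma ole_gtF a b : a <=o b -> ~ b <o a.
Proof. by move=> ab ba; apply: (@olt_irrefl a); exact: ole_lt_trans ab ba. Qed.

Lemma oltNge a b : ~ a <=o b -> b <o a.
Proof. by case: (ole_total a b). Qed.

Lemma oleNgt a b : ~ a <o b -> b <=o a.
Proof. by case: (ole_total b a). Qed.

Lemma omin_exists (P : ord -> Prop) a : P a ->
  exists2 b, P b & forall c, P c -> b <=o c.
Proof.
elim/olt_ind: a => a IH Pa.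
have [[b ba Pb]|nP] := pselect (exists2 b, b <o a & P b); first exact: IH ba Pb.
exists a => // c Pc; apply: oleNgt => ca; by apply: nP; exists c.
Qed.

#[global] Instance oeq_equivalence : Equivalence oeq.
Proof.
split=> [a|a b []|a b c [ab ba] [bc cb]]; first by split; exact: ole_refl.
  by split.
by split; [exact: ole_trans ab bc|exact: ole_trans cb ba].
Qed.

#[global] Instance ole_oeq :
  Proper (respectful oeq (respectful oeq iff)) ole.
Proof.
move=> a a' [aa' a'a] b b' [bb' b'b]; split=> ab.
  exact: ole_trans (ole_trans a'a ab) bb'.
exact: ole_trans (ole_trans aa' ab) b'b.
Qed.

#[global] Instance olt_oeq :
  Proper (respectful oeq (respectful oeq iff)) olt.
Proof.
move=> a a' [aa' a'a] b b' [bb' b'b]; split=> ab.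
  exact: ole_lt_trans a'a (olt_le_trans ab bb').
exact: ole_lt_trans aa' (olt_le_trans ab b'b).
Qed.

Lemma ole_eqVlt a b : a <=o b -> a =o b \/ a <o b.
Proof. by move=> ab; case: (ole_total b a) => [ba|]; [left|right]. Qed.

Lemma oeq_ltP a b : (forall c, c <o a <-> c <o b) -> a =o b.
Proof. by move=> ab; split; apply/oleP => c /ab. Qed.

Lemma ole0 a : ozero <=o a.
Proof. by apply: ole_child => -[]. Qed.

Lemma olt0 a : ~ a <o ozero.
Proof. by case=> -[]. Qed.

Lemma oposP a : ~ a =o ozero -> ozero <o a.
Proof. by move=> a0; apply: oltNge => a0'; apply: a0; split=> //; exact: ole0. Qed.

Lemma olt_succ a b : a <o osucc b <-> a <=o b.
Proof. by split=> [[]|ab] //; exists tt. Qed.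

Lemma osucc_le a b : osucc a <=o b <-> a <o b.
Proof. by split=> [/oleP|ab]; [apply; apply/olt_succ; exact: ole_refl|apply: ole_child]. Qed.

Lemma onat_succ n : onat n.+1 = osucc (onat n). Proof. by []. Qed.

Lemma olt_olub (I : Type) (f : I -> ord) a :
  a <o olub f <-> exists i, a <o f i.
Proof.
split=> [[[i k] ai]|[i [k ai]]]; first by exists i, k.
by exists (existT _ i k).
Qed.

Lemma olt_omax a b c : a <o omax b c <-> a <o b \/ a <o c.
Proof.
split; first by move=> /olt_olub[[]]; [left|right].
by case=> ?; apply/olt_olub; [exists true|exists false].
Qed.

Lemma olt_oadd a b c : c <o oadd a b <-> c <o a \/ exists2 d, d <o b & c <=o oadd a d.
Proof.
(* [oadd] recurses on the children of [b], which are only cofinal below [b];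
   monotony extends the description to all ordinals below [b]. *)
have mono : forall b a d, d <=o b -> oadd a d <=o oadd a b.
  clear; move=> b a; elim: b => J g IH [I f] dg.
  apply/oleP => c /= /olt_omax[ca|[i ci]]; apply/olt_omax; first by left.
  by right; have [j ij] := dg i; exists j; apply: ole_trans ci (IH _ _ ij).
case: b => J g; split.
  move=> /= /olt_omax[ca|[j cj]]; [by left|right].
  by exists (g j); [exact: (@olt_child (OSup g))|].
case=> [ca|[d [j dj] cd]] /=; apply/olt_omax; [by left|right].
by exists j; apply: ole_trans cd _; exact: mono.
Qed.

Lemma oadd_ler a b d : d <=o b -> oadd a d <=o oadd a b.
Proof.
move=> db; apply/oleP => c /olt_oadd[ca|[e ed ce]]; apply/olt_oadd; first by left.
by right; exists e => //; exact: olt_le_trans ed db.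
Qed.

Lemma oadd_ltr a b d : d <o b -> oadd a d <o oadd a b.
Proof. by move=> db; apply/olt_oadd; right; exists d => //; exact: ole_refl. Qed.

Lemma ole_oaddr a b : a <=o oadd a b.
Proof. by apply/oleP => c ca; apply/olt_oadd; left. Qed.

Lemma oadd_le a a' b b' : a <=o a' -> b <=o b' -> oadd a b <=o oadd a' b'.
Proof.
move=> aa' bb'; apply: ole_trans (oadd_ler _ bb').
elim/olt_ind: b {b' bb'} => b IH; apply/oleP => c /olt_oadd[ca|[d db cd]].
  by apply/olt_oadd; left; exact: olt_le_trans ca aa'.
by apply/olt_oadd; right; exists d => //; exact: ole_trans cd (IH _ db).
Qed.

#[global] Instance oadd_oeq :
  Proper (respectful oeq (respectful oeq oeq)) oadd.
Proof. by move=> a a' [aa' a'a] b b' [bb' b'b]; split; exact: oadd_le. Qed.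

Lemma oadd0 a : oadd a ozero =o a.
Proof.
split; last exact: ole_oaddr.
by apply/oleP => c /olt_oadd[|[d /olt0]].
Qed.

(** The remainder is the least [r] with [a <=o oadd b r]. *)
Lemma oadd_subP a b q : b <=o a -> a <o oadd b q ->
  exists2 r, r <o q & a =o oadd b r.
Proof.
move=> ba abq; have [r ar rmin] := @omin_exists (fun r => a <=o oadd b r) _ (oltW abq).
have rq : r <o q.
  move/olt_oadd: abq => [/(ole_gtF ba)//|[d dq /rmin rd]].
  exact: ole_lt_trans rd dq.
exists r => //; split=> //; apply/oleP => c /olt_oadd[/olt_le_trans|]; first exact.
move=> [d dr cd]; apply: ole_lt_trans cd _; apply: oltNge => /rmin.
by move=> /ole_gtF; exact.
Qed.

Lemma olt_omul a b c : c <o omul a b <-> exists2 d, d <o b & c <o oadd (omul a d) a.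
Proof.
have mono : forall d b, d <=o b -> omul a d <=o omul a b.
  clear; elim=> I f IH [J g] fg; apply/oleP => c /= /olt_olub[i ci].
  apply/olt_olub; have [j ij] := fg i; exists j.
  by apply: olt_le_trans ci _; apply: oadd_le (ole_refl _); exact: IH.
case: b => J g; split => /= [/olt_olub[j cj]|[d [j dj] cd]].
  by exists (g j) => //; exact: (@olt_child (OSup g)).
apply/olt_olub; exists j; apply: olt_le_trans cd _.
by apply: oadd_le (ole_refl _); exact: mono.
Qed.

Lemma omul_le a a' b b' : a <=o a' -> b <=o b' -> omul a b <=o omul a' b'.
Proof.
move=> aa'; elim/olt_ind: b b' => b IH b' bb'.
apply/oleP => c /olt_omul[d db cd]; apply/olt_omul; exists d.
  exact: olt_le_trans db bb'.
by apply: olt_le_trans cd _; apply: oadd_le => //; apply: IH => //; exact: ole_refl.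
Qed.

#[global] Instance omul_oeq :
  Proper (respectful oeq (respectful oeq oeq)) omul.
Proof. by move=> a a' [aa' a'a] b b' [bb' b'b]; split; exact: omul_le. Qed.

Lemma omul0 a : omul a ozero =o ozero.
Proof. by split; [apply/oleP => c /olt_omul[d /olt0]|exact: ole0]. Qed.

Lemma omul_succ a b : omul a (osucc b) =o oadd (omul a b) a.
Proof.
apply: oeq_ltP => c; split.
  case/olt_omul => d /olt_succ db cd; apply: olt_le_trans cd _.
  apply: oadd_le (ole_refl _); apply/oleP => e /olt_omul[k kd ek].
  by apply/olt_omul; exists k => //; exact: olt_le_trans kd db.
by move=> cb; apply/olt_omul; exists b => //; apply/olt_succ; exact: ole_refl.
Qed.

Lemma olt_oone c : c <o oone <-> c =o ozero.
Proof.
rewrite /oone onat_succ; split=> [/olt_succ c0|->]; first by split=> //; exact: ole0.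
by apply/olt_succ; exact: ole_refl.
Qed.

(** The three recursive operations are defined from the children of their last
    argument.  This lemma, [olt_oadd] and [olt_omul] restate them in terms of all
    smaller ordinals, after which trees are no longer inspected. *)
Lemma olt_oexpw b c :
  c <o oexpw b <-> c =o ozero \/ exists2 d, d <o b & c <o omul (oexpw d) oomega.
Proof.
have node I (f : I -> ord) e : e <o oexpw (OSup f) <->
    e <o oone \/ exists i, e <o omul (oexpw (f i)) oomega.
  split=> [/olt_omax[|/olt_olub]|]; [by left|by right|].
  by move=> h; apply/olt_omax; case: h; [left|right; apply/olt_olub].
have mono : forall d b, d <=o b -> oexpw d <=o oexpw b.
  clear -node; elim=> I f IH [J g] fg; apply/oleP => c /node[c1|[i ci]]; apply/node.
    by left.
  right; have [j /IH ij] := fg i; exists j; apply: olt_le_trans ci _.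
  by apply: omul_le; [exact: ij|exact: ole_refl].
case: b => J g; split.
  case/node => [/olt_oone|[j cj]]; [by left|right].
  by exists (g j) => //; exact: (@olt_child (OSup g)).
case=> [c0|[d [j dj] cd]]; apply/node; first by left; apply/olt_oone.
right; exists j; apply: olt_le_trans cd _.
by apply: omul_le; [exact: mono|exact: ole_refl].
Qed.

(** * Natural sum *)

(** Conway's recursion for the Hessenberg sum: the least ordinal above all
    [nsum a' b] and [nsum a b'] with [a' <o a] and [b' <o b].  Cantor normal forms
    do not appear in it, so its monotony, commutativity and associativity are
    inductions on trees; [hsumE] identifies it with the coefficientwise sum. *)
Fixpoint nsum (a : ord) : ord -> ord :=
  match a with OSup A f =>
    fix nsum_a (b : ord) : ord :=
      match b with OSup B g =>
        OSup (fun s : A + B => match s with inl i => nsum (f i) b | inr j => nsum_a (g j) end)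
      end
  end.

Lemma nsum_le a a' b b' : a <=o a' -> b <=o b' -> nsum a b <=o nsum a' b'.
Proof.
elim: a a' b b' => A f IHf [A' f'] b b' aa'; elim: b b' => B g IHg [B' g'] bb' [i|j] /=.
  by have [i' ii'] := aa' i; exists (inl i'); exact: IHf.
by have [j' jj'] := bb' j; exists (inr j'); exact: IHg.
Qed.

#[global] Instance nsum_oeq :
  Proper (respectful oeq (respectful oeq oeq)) nsum.
Proof. by move=> a a' [aa' a'a] b b' [bb' b'b]; split; exact: nsum_le. Qed.

Lemma olt_nsum a b c : c <o nsum a b <->
  (exists2 d, d <o a & c <=o nsum d b) \/ (exists2 d, d <o b & c <=o nsum a d).
Proof.
case: a b => A f [B g]; split.
  case=> [[i|j] /= cij]; [left; exists (f i)|right; exists (g j)] => //.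
    exact: (@olt_child (OSup f)).
  exact: (@olt_child (OSup g)).
case=> [[d [i di]]|[d [j dj]]] /ole_trans cd; [exists (inl i)|exists (inr j)]; apply: cd.
  exact: (nsum_le di (ole_refl (OSup g))).
exact: (nsum_le (ole_refl (OSup f)) dj).
Qed.

Lemma nsum_ltl a b d : d <o a -> nsum d b <o nsum a b.
Proof. by move=> da; apply/olt_nsum; left; exists d => //; exact: ole_refl. Qed.

Lemma nsum_ltr a b d : d <o b -> nsum a d <o nsum a b.
Proof. by move=> db; apply/olt_nsum; right; exists d => //; exact: ole_refl. Qed.

Lemma nsum_lt_le a b c d : a <o c -> b <=o d -> nsum a b <o nsum c d.
Proof. by move=> ac bd; apply: olt_le_trans (nsum_ltl b ac) (nsum_le (ole_refl _) bd). Qed.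

Lemma nsumC a b : nsum a b =o nsum b a.
Proof.
suff le : forall a b, nsum a b <=o nsum b a by split; exact: le.
elim=> A f IHf; elim=> B g IHg [i|j] /=.
  by exists (inr i); exact: (IHf i (OSup g)).
by exists (inl j); exact: IHg.
Qed.

Lemma nsumA a b c : nsum a (nsum b c) =o nsum (nsum a b) c.
Proof.
have le : forall a b c, nsum a (nsum b c) <=o nsum (nsum a b) c.
  elim=> A f IHf; elim=> B g IHg; elim=> C h IHh [i|[j|k]] /=.
  - by exists (inl (inl i)); exact (IHf i (OSup g) (OSup h)).
  - by exists (inl (inr j)); exact: (IHg j (OSup h)).
  - by exists (inr k); exact: IHh.
split; first exact: le.
by rewrite (nsumC (nsum a b)) (nsumC a b) (nsumC a) (nsumC b c); exact: le.
Qed.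

Lemma nsumCA a b c : nsum a (nsum b c) =o nsum b (nsum a c).
Proof. by rewrite !nsumA (nsumC a b); reflexivity. Qed.

Lemma nsum0 a : nsum a ozero =o a.
Proof.
elim/olt_ind: a => a IH; apply: oeq_ltP => c; split.
  case/olt_nsum=> -[d]; last by move/olt0.
  by move=> da; rewrite (IH d da) => cd; exact: ole_lt_trans cd da.
by move=> ca; apply/olt_nsum; left; exists c => //; rewrite (IH c ca); exact: ole_refl.
Qed.

Lemma n0sum a : nsum ozero a =o a.
Proof. by rewrite nsumC; exact: nsum0. Qed.

Lemma ole_nsumr a b : b <=o nsum a b.
Proof. by rewrite -{1}(n0sum b); exact: nsum_le (ole0 _) (ole_refl _). Qed.

Lemma oadd_le_nsum a b : oadd a b <=o nsum a b.
Proof.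
elim/olt_ind: b => b IH; apply/oleP => c /olt_oadd[ca|[d db cd]].
  by apply: olt_le_trans ca _; rewrite nsumC; exact: ole_nsumr.
by apply: ole_lt_trans cd _; apply: ole_lt_trans (IH d db) (nsum_ltr _ db).
Qed.

Definition nmul (q : ord) (n : nat) : ord := iter n (nsum q) ozero.

Lemma nmulS q n : nmul q n.+1 = nsum q (nmul q n). Proof. by []. Qed.

Lemma nmul_le q r m n : q <=o r -> (m <= n)%N -> nmul q m <=o nmul r n.
Proof.
move=> qr; elim: n m => [|n IH] [|m] // mn; try exact: ole0.
by rewrite !nmulS; apply: nsum_le => //; exact: IH.
Qed.

#[global] Instance nmul_oeq :
  Proper (respectful oeq (respectful eq oeq)) nmul.
Proof. by move=> q r [qr rq] m _ <-; split; exact: nmul_le. Qed.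

Lemma nmulD q m n : nmul q (m + n) =o nsum (nmul q m) (nmul q n).
Proof.
elim: m => [|m IH]; first by rewrite n0sum; reflexivity.
by rewrite addSn !nmulS IH nsumA; reflexivity.
Qed.

Lemma nmul0n n : nmul ozero n =o ozero.
Proof. by elim: n => [|n IH]; [reflexivity|rewrite nmulS IH; exact: nsum0]. Qed.

(** The nonzero closed ordinals are the powers of [omega]; closure is all that the
    computations with multiples of such a power need. *)
Definition nclosed (q : ord) : Prop :=
  forall a b, a <o q -> b <o q -> nsum a b <o q.

(** Below [n + 1] copies of [q], one copy can be made smaller, because
    a natural sum is approached by decreasing one of its terms. *)
Lemma olt_nmulS q n a : a <o nmul q n.+1 ->
  exists2 d, d <o q & a <=o nsum (nmul q n) d.
Proof.
elim: n a => [|n IH] a; rewrite nmulS => /olt_nsum[[d dq ad]|[d]].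
- by exists d => //; apply: ole_trans ad _; rewrite nsumC; exact: ole_refl.
- by move/olt0.
- by exists d => //; rewrite nsumC.
- case/IH=> e eq de ad; exists e => //; apply: ole_trans ad _.
  by rewrite nmulS -nsumA; exact: nsum_le (ole_refl _) de.
Qed.

(** Adding on the right to a multiple of a closed ordinal [q] loses nothing, as
    long as the added ordinal is at most [q].  The upper bound is the point: an
    ordinal below the natural sum is below one where a term has decreased.  If this
    term is [nmul q n], one copy of [q] in it becomes some [d <o q], and [d] can be
    merged with [c] by closure when [c <o q]; when [c] is [q] itself, [c] takes the
    place of the lost copy and [d] that of [c]. *)
Lemma nmul_oadd q n c : nclosed q -> c <=o q -> oadd (nmul q n) c =o nsum (nmul q n) c.
Proof.
move=> qcl; elim/olt_ind: c => c IH cq; split; first exact: oadd_le_nsum.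
apply/oleP => x /olt_nsum[[a]|[d dc]]; last first.
  rewrite -(IH _ dc) => [xd|]; first by apply: ole_lt_trans xd _; exact: oadd_ltr.
  exact: ole_trans (oltW dc) cq.
case: n IH => [|n] IH; first by move/olt0.
case/olt_nmulS => d dq ad xa.
have {a ad xa}xd : x <=o nsum (nsum (nmul q n) d) c.
  exact: ole_trans xa (nsum_le ad (ole_refl _)).
have [ceq|cltq] := ole_eqVlt cq.
  apply: ole_lt_trans xd _; rewrite -nsumA (nsumC d) nsumA ceq (nsumC _ q) -nmulS.
  by rewrite -IH ?ceq //; [exact: oadd_ltr|exact: oltW].
apply: ole_lt_trans xd _; rewrite -nsumA.
apply: olt_le_trans (ole_oaddr _ _); rewrite nmulS (nsumC q); apply: nsum_ltr.
exact: qcl.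
Qed.

Lemma omul_onat q n : nclosed q -> omul q (onat n) =o nmul q n.
Proof.
move=> qcl; elim: n => [|n IH]; first exact: omul0.
by rewrite onat_succ omul_succ IH nmul_oadd //; [rewrite nsumC; reflexivity|exact: ole_refl].
Qed.

(** Euclidean division: subtract copies of [q] as long as possible. *)
Lemma nclosed_divn q a n : nclosed q -> a <o nmul q n ->
  exists m r, r <o q /\ a =o nsum (nmul q m) r.
Proof.
move=> qcl; elim: n => [/olt0//|n IH]; have [|/IH//] := ole_total (nmul q n) a.
move=> na; rewrite nmulS nsumC -nmul_oadd //; last exact: ole_refl.
case/(oadd_subP na) => r rq ar; exists n, r; split=> //.
by rewrite ar nmul_oadd //; [reflexivity|exact: oltW].
Qed.

(** * Weights *)

(** The least ordinal above all finite natural multiples of the weights of smaller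
    ordinals.  This is exactly the height that a principal element [U x] of the
    hyperspace must have when [x] has height [a], since the elements close to [U x]
    are finite unions of [U y] with [y] of smaller height.  It gives the values
    0, 1 and [oexpw] of the statement at once. *)
Fixpoint wt (a : ord) : ord :=
  match a with OSup A f => OSup (fun p : A * nat => nmul (wt (f p.1)) p.2) end.

Lemma wt_le a b : a <=o b -> wt a <=o wt b.
Proof.
elim: a b => A f IH [B g] ab [i n] /=; have [j ij] := ab i.
by exists (j, n); apply: nmul_le => //; exact: IH.
Qed.

#[global] Instance wt_oeq :
  Proper (respectful oeq oeq) wt.
Proof. by move=> a b [ab ba]; split; exact: wt_le. Qed.

Lemma olt_wt a c : c <o wt a <-> exists b n, b <o a /\ c <=o nmul (wt b) n.
Proof.
case: a => A f; split=> [[[i n] /= cin]|[b [n [[i bi] cn]]]].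
  by exists (f i), n; split=> //; exact: (@olt_child (OSup f)).
by exists (i, n); apply: ole_trans cn _; apply: nmul_le => //; exact: wt_le.
Qed.

Lemma nmul_wt_lt a b n : b <o a -> nmul (wt b) n <o wt a.
Proof. by move=> ba; apply/olt_wt; exists b, n; split=> //; exact: ole_refl. Qed.

Lemma wt_lt a b : b <o a -> wt b <o wt a.
Proof. by move/(nmul_wt_lt 1); rewrite nmulS nsum0. Qed.

Lemma nclosed_wt a : nclosed (wt a).
Proof.
move=> c d /olt_wt[b [m [ba cm]]] /olt_wt[b' [n [b'a dn]]].
have {cm dn}le e : b <=o e -> b' <=o e -> nsum c d <=o nmul (wt e) (m + n).
  move=> be b'e; rewrite nmulD.
  by apply: nsum_le; [apply: ole_trans cm _|apply: ole_trans dn _];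
     apply: nmul_le => //; exact: wt_le.
apply/olt_wt; have [bb'|/oltW b'b] := ole_total b b'.
  by exists b', (m + n)%N; split=> //; apply: le => //; exact: ole_refl.
by exists b, (m + n)%N; split=> //; apply: le => //; exact: ole_refl.
Qed.

Lemma wt0 : wt ozero =o ozero.
Proof. by split; [apply/oleP => c /olt_wt[b [n [/olt0]]]|exact: ole0]. Qed.

Lemma wt_gt0 a : ozero <o a -> ozero <o wt a.
Proof. by move=> a0; apply/olt_wt; exists ozero, 0%N; split=> //; exact: ole0. Qed.

Lemma olt_omul_omega q c : c <o omul q oomega <-> exists n, c <o omul q (onat n).
Proof.
split=> [/olt_omul[d [n dn] cd]|[n cn]].
  exists n.+1; rewrite onat_succ omul_succ; apply: olt_le_trans cd _.
  by apply: oadd_le (ole_refl _); exact: omul_le (ole_refl _) dn.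
apply: olt_le_trans cn (omul_le (ole_refl _) (oltW _)).
exact: (@olt_child oomega).
Qed.

#[global] Instance nclosed_oeq :
  Proper (respectful oeq iff) nclosed.
Proof. by move=> a b ab; split=> cl c d; rewrite ?ab -?ab; move: (cl c d); rewrite ?ab -?ab. Qed.

Lemma olt_oone_add a b : b <o oadd oone a <-> b =o ozero \/ exists2 d, d <o a & b <=o oadd oone d.
Proof.
split=> [/olt_oadd[/olt_oone b0|]|[b0|db]]; [by left|by right| |].
  by apply/olt_oadd; left; apply/olt_oone.
by apply/olt_oadd; right.
Qed.

(** Going from [b] to [b + 1] replaces the weight by the supremum of its finite
    multiples, which by closure is its product with [omega]; the shift by one comes
    from the weight of 0 being 0, whereas [omega] to the power 0 is 1. *)
Lemma wt_oexpw a : wt (oadd oone a) =o oexpw a.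
Proof.
elim/olt_ind: a => a IH; apply: oeq_ltP => c; split.
  case/olt_wt=> b [n [/olt_oone_add[b0|[d da bd]] cn]]; apply/olt_oexpw.
    by left; split; [move: cn; rewrite b0 wt0 nmul0n|exact: ole0].
  right; exists d => //; apply/olt_omul_omega; exists n.+1.
  rewrite -(IH d da) omul_onat; last exact: nclosed_wt.
  apply: ole_lt_trans cn _; rewrite nmulS.
  have le := nmul_le (wt_le bd) (leqnn n); apply: ole_lt_trans le _.
  rewrite -{1}(n0sum (nmul _ n)); apply: nsum_ltl; apply: wt_gt0.
  by apply/olt_oone_add; left; reflexivity.
case/olt_oexpw=> [c0|[d da /olt_omul_omega[n]]].
  by rewrite c0; apply: wt_gt0; apply/olt_oone_add; left; reflexivity.
rewrite -(IH d da) omul_onat; last exact: nclosed_wt.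
move=> /oltW cn; apply/olt_wt; exists (oadd oone d), n; split=> //.
exact: oadd_ltr.
Qed.

(** * The natural sum of Cantor normal forms *)

Lemma nclosed_oexpw e : nclosed (oexpw e).
Proof. by rewrite -wt_oexpw; exact: nclosed_wt. Qed.

Lemma oexpw_gt0 e : ozero <o oexpw e.
Proof. by rewrite -wt_oexpw; apply: wt_gt0; apply/olt_oone_add; left; reflexivity. Qed.

Lemma nmul_oexpw_lt d e n : d <o e -> nmul (oexpw d) n <o oexpw e.
Proof. by move=> de; rewrite -!wt_oexpw; apply: nmul_wt_lt; exact: oadd_ltr. Qed.

Lemma olt_oexpw_nmul e c : ozero <o e -> c <o oexpw e ->
  exists2 d, d <o e & exists n, c <o nmul (oexpw d) n.
Proof.
move=> e0 /olt_oexpw[c0|[d de /olt_omul_omega[n cn]]].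
  exists ozero => //; exists 1%N; rewrite c0 nmulS nsum0; exact: oexpw_gt0.
by exists d => //; exists n; rewrite -omul_onat //; exact: nclosed_oexpw.
Qed.

Definition exp_gt {T : Type} (p q : ord * T) : Prop := q.1 <o p.1.

(** Each step of the evaluation of a Cantor normal form is a natural sum, which
    makes coefficients add up in [ocnf_nsum]. *)
Lemma ocnf_cons e n r : r <o oexpw e ->
  oadd (omul (oexpw e) (onat n)) r =o nsum (nmul (oexpw e) n) r.
Proof.
move=> re; rewrite omul_onat; last exact: nclosed_oexpw.
by apply: nmul_oadd; [exact: nclosed_oexpw|exact: oltW].
Qed.

Lemma ocnf_tail_lt T (g : T -> nat) (p : ord * T) t : Sorted.Sorted exp_gt (p :: t) ->
  ocnf [seq (q.1, g q.2) | q <- t] <o oexpw p.1.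
Proof.
elim: t p => [|q t IH] p; first by move=> _; exact: oexpw_gt0.
move=> spt; have [st hd] := Sorted.Sorted_inv spt; have qp := Sorted.HdRel_inv hd.
have tq := IH _ st; rewrite /= ocnf_cons //.
apply: olt_trans (nsum_ltr _ tq) _; rewrite nsumC -nmulS; exact: nmul_oexpw_lt.
Qed.

Lemma ocnf_nsum (t : seq (ord * (nat * nat))) : Sorted.Sorted exp_gt t ->
  ocnf [seq (p.1, (p.2.1 + p.2.2)%N) | p <- t] =o
  nsum (ocnf [seq (p.1, p.2.1) | p <- t]) (ocnf [seq (p.1, p.2.2) | p <- t]).
Proof.
elim: t => [|p t IH] st; first by symmetry; exact: nsum0.
have [st' _] := Sorted.Sorted_inv st.
have lt g := @ocnf_tail_lt _ g _ _ st.
rewrite /= !ocnf_cons; first last.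
- exact: lt (fun q => (q.1 + q.2)%N).
- exact: lt (fun q => q.1).
- exact: lt (fun q => q.2).
rewrite (IH st') nmulD -!nsumA; apply: nsum_oeq; first reflexivity.
by rewrite nsumCA; reflexivity.
Qed.

Lemma is_hsum_nsum a b c : is_hsum a b c -> c =o nsum a b.
Proof. by case=> t [st -> -> ->]; exact: ocnf_nsum. Qed.

(** Dividing both ordinals by the same power of [omega], with the largest relevant
    exponent [f], yields the leading coefficients; the remainders are below
    [oexpw f], and the induction applies to them.  Allowing zero coefficients spares
    a comparison of the two leading exponents. *)
Lemma common_cnf e a b : a <o oexpw e -> b <o oexpw e ->
  exists t : seq (ord * (nat * nat)),
    [/\ Sorted.Sorted exp_gt t,
        forall p, e <=o p.1 -> Sorted.HdRel exp_gt p t,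
        a =o ocnf [seq (p.1, p.2.1) | p <- t] &
        b =o ocnf [seq (p.1, p.2.2) | p <- t]].
Proof.
elim/olt_ind: e a b => e IH a b ae be.
have [e0|/oposP e0] := pselect (e =o ozero).
  have z c : c <o oexpw e -> c =o ozero.
    by case/olt_oexpw => [//|[d]]; rewrite e0 => /olt0.
  by exists [::]; split; [constructor|move=> p _; constructor|exact: z|exact: z].
have [f fe [k [af bf]]] : exists2 f, f <o e &
    exists k, a <o nmul (oexpw f) k /\ b <o nmul (oexpw f) k.
  have [d de [m am]] := olt_oexpw_nmul e0 ae; have [d' d'e [n bn]] := olt_oexpw_nmul e0 be.
  have le f : d <=o f -> d' <=o f ->
      a <o nmul (oexpw f) (m + n) /\ b <o nmul (oexpw f) (m + n).
    move=> df d'f; split; [apply: olt_le_trans am _|apply: olt_le_trans bn _];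
      rewrite -!wt_oexpw; (apply: nmul_le; last by rewrite ?leq_addr ?leq_addl);
      by apply: wt_le; exact: oadd_ler.
  have [dd'|/oltW d'd] := ole_total d d'; [exists d' => //|exists d => //];
    by exists (m + n)%N; apply: le => //; exact: ole_refl.
have [m [r [rf ar]]] := nclosed_divn (@nclosed_oexpw f) af.
have [n [s [sf bs]]] := nclosed_divn (@nclosed_oexpw f) bf.
have [t [st hdt rt stt]] := IH f fe r s rf sf.
exists ((f, (m, n)) :: t); split.
- by constructor => //; apply: hdt; exact: ole_refl.
- by move=> p ep; constructor; exact: olt_le_trans fe ep.
- by rewrite /= ocnf_cons -?rt.
- by rewrite /= ocnf_cons -?stt.
Qed.

Lemma ole_oexpw a : a <=o oexpw a.
Proof.
elim/olt_ind: a => a IH; apply/oleP => c ca; apply: ole_lt_trans (IH _ ca) _.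
by move: (nmul_oexpw_lt 1 ca); rewrite nmulS nsum0.
Qed.

(** Common normal forms exist, so [hsum] is not its default value, and whichever
    witness is chosen, its value is the natural sum. *)
Lemma hsumE a b : hsum a b =o nsum a b.
Proof.
rewrite /hsum /othe; case: pselect => [ex|[]]; first exact: is_hsum_nsum (projT2 (cid ex)).
pose e := osucc (omax a b).
have lt c : c <=o omax a b -> c <o oexpw e.
  move=> cab; apply: ole_lt_trans cab _; apply: ole_lt_trans (ole_oexpw _) _.
  have /(nmul_oexpw_lt 1) : omax a b <o e by apply/olt_succ; exact: ole_refl.
  by rewrite nmulS nsum0.
have [||t [st _ at_ bt]] := @common_cnf e a b.
- by apply: lt; apply/oleP => c ca; apply/olt_omax; left.
- by apply: lt; apply/oleP => c ca; apply/olt_omax; right.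
by exists (ocnf [seq (p.1, (p.2.1 + p.2.2)%N) | p <- t]), t; split=> //; reflexivity.
Qed.

(** * Natural sums over lists *)

Section BigNsum.
Variable T : eqType.
Implicit Types (s t : seq T) (F : T -> ord) (P : pred T).

Lemma eq_big_hsum s F G : (forall x, x \in s -> F x =o G x) ->
  \big[hsum/ozero]_(x <- s) F x =o \big[nsum/ozero]_(x <- s) G x.
Proof.
elim: s => [|x s IH] FG; first by rewrite !big_nil; reflexivity.
rewrite !big_cons hsumE FG ?mem_head // IH; first reflexivity.
by move=> y ys; apply: FG; rewrite inE ys orbT.
Qed.

Lemma big_nsum_cat s t F :
  \big[nsum/ozero]_(x <- s ++ t) F x =o
  nsum (\big[nsum/ozero]_(x <- s) F x) (\big[nsum/ozero]_(x <- t) F x).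
Proof.
elim: s => [|x s IH] /=; first by rewrite big_nil n0sum; reflexivity.
by rewrite !big_cons IH nsumA; reflexivity.
Qed.

(** [nsum] is commutative and associative up to [=o] only, so the general results
    on iterated operators do not apply to it. *)
Lemma perm_big_nsum s t F : perm_eq s t ->
  \big[nsum/ozero]_(x <- s) F x =o \big[nsum/ozero]_(x <- t) F x.
Proof.
move=> st; symmetry.
pose P u := \big[nsum/ozero]_(x <- u) F x =o \big[nsum/ozero]_(x <- s) F x.
apply: (@catCA_perm_ind _ P _ _ _ st); last by rewrite /P; reflexivity.
by move=> s1 s2 s3; rewrite /P => <-; rewrite !big_nsum_cat nsumCA; reflexivity.
Qed.

Lemma big_nsum_filter s F P : \big[nsum/ozero]_(x <- s) F x =o
  nsum (\big[nsum/ozero]_(x <- [seq x <- s | P x]) F x)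
       (\big[nsum/ozero]_(x <- [seq x <- s | ~~ P x]) F x).
Proof. by rewrite -big_nsum_cat; apply: perm_big_nsum; rewrite perm_sym perm_filterC. Qed.

Lemma big_nsum_lt s F q : nclosed q -> ozero <o q -> (forall x, x \in s -> F x <o q) ->
  \big[nsum/ozero]_(x <- s) F x <o q.
Proof.
move=> qcl q0; elim: s => [|x s IH] Fq; first by rewrite big_nil.
rewrite big_cons; apply: qcl; first by apply: Fq; exact: mem_head.
by apply: IH => y ys; apply: Fq; rewrite inE ys orbT.
Qed.

Lemma big_nsum_const s F a : (forall x, x \in s -> F x =o a) ->
  \big[nsum/ozero]_(x <- s) F x =o nmul a (size s).
Proof.
elim: s => [|x s IH] Fa; first by rewrite big_nil; reflexivity.
rewrite big_cons Fa ?mem_head // IH; first reflexivity.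
by move=> y ys; apply: Fa; rewrite inE ys orbT.
Qed.

(** Below a natural sum, one of the terms can be decreased. *)
Lemma olt_big_nsum s F c : c <o \big[nsum/ozero]_(x <- s) F x ->
  exists x, x \in s /\ exists2 d, d <o F x &
    c <=o nsum d (\big[nsum/ozero]_(y <- rem x s) F y).
Proof.
elim: s c => [|x s IH] c; first by rewrite big_nil => /olt0.
rewrite big_cons => /olt_nsum[[d dx cd]|[d /IH[y [ys [e ey de]]] cd]].
  by exists x; rewrite mem_head /= eqxx; split=> //; exists d.
exists y; rewrite inE ys orbT; split=> //; exists e => //=.
apply: ole_trans cd _; case: eqP => [->|_]; last first.
  by rewrite big_cons nsumCA; exact: nsum_le (ole_refl _) de.
by rewrite (perm_big_nsum F (perm_to_rem ys)) big_cons nsumCA; exact: nsum_le (ole_refl _) de.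
Qed.
End BigNsum.

(** * Cantor-Bendixson ranks *)

Section Rank.
Variable T : topologicalType.
Implicit Types (A N : set T) (x y : T) (h : T -> ord).

Lemma cbderivP A x : cbderiv A x <->
  A x /\ forall N, nbhs x N -> exists y, [/\ N y, y <> x & A y].
Proof.
split=> [[Ax nis]|[Ax lim]]; split=> //.
  move=> N xN; apply: contrapT => noy; apply: nis; split; first by rewrite inE.
  exists N => //; apply/seteqP; split=> [y [Ny Ay]|_ ->] /=.
    by apply: contrapT => yx; apply: noy; exists y.
  by split=> //; exact: nbhs_singleton.
move=> [_ [N xN NA]]; have [y [Ny yx Ay]] := lim N xN; apply: yx.
by have : (N `&` A) y by []; rewrite NA.
Qed.

Lemma cb_open A a x : open A -> cb A a x <-> A x /\ cb [set: T] a x.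
Proof.
move=> oA; elim/olt_ind: a x => a IH x.
split=> [/cbP[Ax xa]|[Ax /cbP[_ xa]]].
  split=> //; apply/cbP; split=> // b ba.
  have /cbderivP[/(IH _ ba)[_ xb] lim] := xa b ba; apply/cbderivP; split=> // N xN.
  by have [y [Ny yx /(IH _ ba)[_ yb]]] := lim N xN; exists y.
apply/cbP; split=> // b ba; have /cbderivP[xb lim] := xa b ba.
apply/cbderivP; split; first exact/(IH _ ba).
move=> N xN; have [|y [[Ny Ay] yx yb]] := lim (N `&` A).
  by apply: filterI => //; exact: open_nbhs_nbhs.
by exists y; split=> //; exact/(IH _ ba).
Qed.

(** The two properties that characterize heights in a scattered space: a point has
    a larger rank than all other points near it, and arbitrarily close to it there
    are points of rank at least any given smaller ordinal. *)
Definition is_rank h : Prop :=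
  (forall x, exists2 N, nbhs x N & forall y, N y -> y <> x -> h y <o h x) /\
  (forall x b N, b <o h x -> nbhs x N -> exists y, [/\ N y, y <> x & b <=o h y]).

(** By induction on [a]: the first property isolates a point of rank [b] among those
    of rank at least [b], the second prevents points of larger rank from being
    isolated there. *)
Lemma cb_rank h A a x : is_rank h -> open A -> cb A a x <-> A x /\ a <=o h x.
Proof.
move=> [loc cof] oA; rewrite cb_open //.
suff -> : cb setT a x <-> a <=o h x by [].
elim/olt_ind: a x => a IH x; split=> [/cbP[_ xa]|ax].
  apply: oleNgt => hxa; have /cbderivP[_ lim] := xa _ hxa.
  have [N xN lt] := loc x; have [y [Ny yx /(IH _ hxa)]] := lim N xN.
  by move/ole_gtF; apply; exact: lt.
apply/cbP; split=> // b ba; have bx := olt_le_trans ba ax.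
apply/cbderivP; split; first by apply/(IH _ ba); exact: oltW.
move=> N xN; have [y [Ny yx by_]] := cof x b N bx xN.
by exists y; split=> //; apply/(IH _ ba).
Qed.

Lemma is_height_rank h A x a : is_rank h -> open A ->
  is_height A x a <-> A x /\ a =o h x.
Proof.
move=> rk oA; rewrite /is_height; split.
  move=> [/(cb_rank _ _ rk oA)[Ax ax] nax]; split=> //; split=> //.
  apply: oleNgt => /osucc_le sax; apply: nax; exact/(cb_rank _ _ rk oA).
move=> [Ax [ax xa]]; split; first exact/(cb_rank _ _ rk oA).
by move=> /(cb_rank _ _ rk oA)[_ /osucc_le]; exact: ole_gtF.
Qed.

Lemma height_rank h A x : is_rank h -> open A -> A x -> height A x =o h x.
Proof.
move=> rk oA Ax; rewrite /height /othe; case: pselect => [ex|[]].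
  by have /(is_height_rank _ _ rk oA)[] := projT2 (cid ex).
by exists (h x); apply/(is_height_rank _ _ rk oA); split=> //; reflexivity.
Qed.

(** A strict maximum of a rank function on [A] is the last point to survive in the
    iterated derivatives of [A]. *)
Lemma unitary_rank h A x : is_rank h -> open A -> A x ->
  (forall y, A y -> y <> x -> h y <o h x) -> unitary_at A x.
Proof.
move=> rk oA Ax lt.
have hA : set_height A =o h x.
  apply: oeq_ltP => c; rewrite olt_olub; split=> [[[y Ay]]|cx].
    rewrite /= (height_rank rk oA Ay) => cy; have [<-//|/lt] := pselect (y = x).
    by move=> /(_ Ay); exact: olt_trans cy.
  by exists (exist _ x Ax); rewrite /= (height_rank rk oA Ax).
apply/seteqP; split=> [y /(cb_rank _ _ rk oA)[Ay]|_ ->].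
  rewrite hA => /ole_gtF yx; apply: contrapT => neq; apply: yx; exact: lt.
by apply/(cb_rank _ _ rk oA); split=> //; rewrite hA; exact: ole_refl.
Qed.

(** A point of least rank among those of rank at least [b], in a neighborhood [O]
    small enough, has rank [b]: otherwise it would be a limit of points of smaller
    rank, still at least [b].  [O] must avoid points outranking [x], so that the
    new point is not [x] itself. *)
Lemma rank_eq h x b N : is_rank h -> b <o h x -> nbhs x N ->
  exists y, [/\ N y, y <> x & h y =o b].
Proof.
move=> [loc cof] bx xN.
have [M xM ltM] := loc x.
have [O [oO Ox] ONM] : exists2 O, open_nbhs x O & O `<=` N `&` M.
  have : nbhs x (N `&` M) by exact: filterI.
  by rewrite nbhsE => -[O xO ONM]; exists O.
have [y [Oy yx by_]] := cof x b O bx (open_nbhs_nbhs (conj oO Ox)).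
pose P c := exists z, [/\ O z, z <> x, b <=o h z & h z =o c].
have [c [z [Oz zx bz zc]] cmin] : exists2 c, P c & forall d, P d -> c <=o d.
  by apply: (@omin_exists P (h y)); exists y; split=> //; reflexivity.
exists z; split=> //; first by have [] := ONM z Oz.
apply: contrapT => zb; have {zb}bz' : b <o h z.
  by have [bz'|//] := ole_eqVlt bz; case: zb; symmetry.
have [L zL ltL] := loc z.
have [|u [[Ou Lu] uz bu]] := cof z b (O `&` L) bz'.
  by apply: filterI => //; exact: open_nbhs_nbhs.
have uz' := ltL u Lu uz.
have ux : u <> x.
  move=> ux; have [_ Mz] := ONM z Oz; apply: (@olt_irrefl (h x)).
  by move: uz'; rewrite ux => /olt_trans; apply; exact: ltM.
have /ole_gtF : c <=o h u by apply: cmin; exists u; split=> //; reflexivity.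
by apply; rewrite -zc.
Qed.

Section Canonical.
Variable U : clopen_selector T.
Hypothesis U_can : canonical_selector U.

(** Derivatives commute with the restriction to the open set [U x], whose last
    nonempty derivative is the singleton of [x]. *)
Lemma is_height_canonical x : is_height setT x (set_height (U x)).
Proof.
have oU := (selector_clopen U x).1; have Ux := U_can x.
have xU : cb (U x) (set_height (U x)) x by rewrite /unitary_at in Ux; rewrite Ux.
split; first by have /(cb_open _ _ oU)[] := xU.
move=> xs; have : cb (U x) (osucc (set_height (U x))) x.
  by apply/(cb_open _ _ oU); split=> //; exact: selector_refl.
move=> /cbP[_ /(_ (set_height (U x)))] []; first by apply/olt_succ; exact: ole_refl.
move=> _; case; split; first by rewrite inE.
by exists (U x); [exact: open_nbhs_nbhs (conj oU (selector_refl U x))|];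
   rewrite -Ux; apply/seteqP; split=> [y []//|y yU]; split=> //;
   have /(cb_open _ _ oU)[] := yU.
Qed.

Lemma cb_height a x : cb setT a x <-> a <=o height setT x.
Proof.
have [xh nxh] : is_height setT x (height setT x).
  rewrite /height /othe; case: pselect => [ex|[]]; first exact: projT2 (cid ex).
  by exists (set_height (U x)); exact: is_height_canonical.
split=> [xa|/cb_le]; last exact.
by apply: oleNgt => /osucc_le/cb_le/(_ _ xa).
Qed.

Lemma height_canonical_lt x y : U x y -> y <> x ->
  height setT y <o height setT x.
Proof.
move=> xy yx; apply: oltNge => hxy; apply: yx.
have oU := (selector_clopen U x).1.
have : cb (U x) (set_height (U x)) y.
  apply/(cb_open _ _ oU); split=> //; apply/cb_height.
  apply: (ole_trans _ hxy); by apply/cb_height; have [] := is_height_canonical x.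
by rewrite U_can.
Qed.

Lemma is_rank_height : is_rank (height [set: T]).
Proof.
split=> [x|x b N bx xN].
  exists (U x); last exact: height_canonical_lt.
  exact: open_nbhs_nbhs (conj (selector_clopen U x).1 (selector_refl U x)).
have /cb_height/cbP[_ /(_ b bx)/cbderivP[_ lim]] := ole_refl (height setT x).
by have [y [Ny yx /cb_height by_]] := lim N xN; exists y.
Qed.
End Canonical.
End Rank.

(** * The hyperspace *)

(** Otherwise the sets whose complement in [K] satisfies [P] form a proper filter,
    which cannot have a cluster point in [K].  In this form, finite subcovers need
    neither indices nor a base point in the space. *)
Lemma compact_ind (T : topologicalType) (K : set T) (P : set T -> Prop) :
  compact K -> P set0 -> (forall A B, A `<=` B -> P B -> P A) ->
  (forall A B, P A -> P B -> P (A `|` B)) ->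
  (forall x, K x -> exists2 N, nbhs x N & P N) -> P K.
Proof.
move=> Kco P0 PS PU loc; apply: contrapT => nPK.
pose F : set_system T := [set A | P (K `\` A)].
have FF : ProperFilter F.
  apply: Build_ProperFilter_ex.
    move=> A FA; apply: contrapT => nA; apply: nPK; apply: PS FA => x Kx; split=> // Ax.
    by apply: nA; exists x.
  split; rewrite /F /=.
  - by rewrite setDT.
  - move=> A B FA FB; change (P (K `\` (A `&` B))).
    by rewrite setDE setCI setIUr -!setDE; exact: PU.
  - by move=> A B AB; apply: PS => x [Kx nBx]; split=> // /AB.
have [x [Kx clx]] : K `&` cluster F !=set0.
  by apply: Kco; rewrite /F /= setDv.
have [N xN PN] := loc x Kx.
have FN : F (~` N) by rewrite /F /= setDE setCK; apply: PS PN => y [].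
by have [y [/= nNy]] := clx _ _ FN xN.
Qed.

Section Hyperspace.
Variables (X : topologicalType) (U : clopen_selector X).
Hypothesis X_compact : compact [set: X].
Implicit Types (x y : X) (A V W : set X) (K L : hyperspace U) (s : {fset X}).
Local Notation "x <=U y" := (sle U x y) (at level 70).

Lemma sleP x y : x <=U y <-> U y x.
Proof. by split=> [/sle_selector|/selector_sub]. Qed.

Lemma sle_trans y x z : x <=U y -> y <=U z -> x <=U z.
Proof. exact: subset_trans. Qed.

Lemma sle_anti x y : x <=U y -> y <=U x -> x = y.
Proof.
move=> /sleP xy /sleP yx; apply: contrapT => /(selector_anti U)[].
  by apply.
by apply.
Qed.

Lemma hyper_eq K L : K `<=` L -> L `<=` K -> K = L.
Proof.
move=> KL LK; have : (K : set X) = L by exact/seteqP.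
case: K L {KL LK} => [K K0 Kc Ki] [L L0 Lc Li] /= KL.
by case: _ / KL in L0 Lc Li *; congr Hyperspace; exact: Prop_irrelevance.
Qed.

Lemma selector_hyper K x : hset K x -> U x `<=` K.
Proof. by move=> Kx y /sleP yx; exact: hset_initial yx Kx. Qed.

Lemma selector_nbhs x : nbhs x (U x).
Proof. exact: open_nbhs_nbhs (conj (selector_clopen U x).1 (selector_refl U x)). Qed.

(** An initial set contains [U x] whenever it contains [x]. *)
Lemma hyper_clopen K : clopen K.
Proof.
split; last exact: hset_closed.
rewrite openE => x Kx; apply: filterS (selector_nbhs x); exact: selector_hyper.
Qed.

Lemma hyper_compact K : compact K.
Proof. by apply: subclosed_compact (@hset_closed _ _ K) X_compact _. Qed.

(** Finitely many of the open sets [U x], for [x] in [K], cover the compact set [K]. *)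
Lemma hyper_finite K : exists s : {fset X},
  [set` s] `<=` K /\ K `<=` Uset U s.
Proof.
pose P A := exists s : {fset X}, [set` s] `<=` K /\ A `<=` Uset U s.
suff : P K by []; apply: (compact_ind (@hyper_compact K)).
- by exists fset0; split.
- by move=> A B AB [s [sK Bs]]; exists s; split=> //; exact: subset_trans Bs.
- move=> A B [s [sK As]] [t [tK Bt]]; exists (s `|` t)%fset; split.
    by move=> x /=; rewrite inE => /orP[/sK|/tK].
  by move=> x [/As|/Bt] [y ys yx]; exists y => //=; rewrite inE ys ?orbT.
- move=> x Kx; exists (U x); first exact: selector_nbhs.
  exists [fset x]%fset; split=> [y /=|y Uxy]; first by rewrite inE => /eqP->.
  by exists x => //=; rewrite inE.
Qed.

Definition maximal_in K x : Prop := hset K x /\ forall y, hset K y -> x <=U y -> x = y.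

(** The antichain is determined by its union: it consists of the maximal points. *)
Lemma antichainP s (s0 : s != fset0) : antichain U s ->
  forall x, x \in s <-> maximal_in (Uhyper U s0) x.
Proof.
move=> ac x; split=> [xs|[[y ys /sleP xy] mx]]; last first.
  by rewrite (mx y) //; exists y => //; exact: selector_refl.
split=> [|y [z zs /sleP yz] xy]; first by exists x => //; exact: selector_refl.
have xz := sle_trans xy yz; have [xez|/ac] := pselect (x = z).
  by apply: sle_anti xy _; rewrite xez.
by move=> /(_ xs zs)[].
Qed.

(** A set of least cardinality among the finite subsets generating [K] is an
    antichain, since a point below another one could be dropped. *)
Lemma hyper_Uset K : exists s (s0 : s != fset0), antichain U s /\ K = Uhyper U s0.
Proof.
pose P n := `[< exists s, [/\ [set` s] `<=` K, K `<=` Uset U s & #|` s| = n] >].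
have exP : exists n, P n.
  by have [s [sK Ks]] := hyper_finite K; exists #|` s|; apply/asboolP; exists s.
have [n /asboolP[s [sK Ks sn]] nmin] := ex_minnP exP.
have s0 : s != fset0.
  have [x /Ks[y ys _]] := hset_neq0 K.
  by apply/fset0Pn; exists y.
have min x y : x \in s -> y \in s -> x <> y -> ~ x <=U y.
  move=> xs ys xy xley; have : P #|` (s `\ x)%fset|.
    apply/asboolP; exists (s `\ x)%fset; split=> // [z /=|z /Ks[u us uz]].
      by rewrite inE => /andP[_ /sK].
    have [ux|/eqP ux] := eqVneq u x; last by exists u => //=; rewrite !inE us andbT; exact/eqP.
    exists y; first by rewrite /= !inE ys andbT; apply/eqP => yx; exact: xy.
    by apply: xley; rewrite -ux.
  by move=> /nmin; rewrite -sn (cardfsD1 x s) xs add1n ltnn.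
exists s, s0; split; first by move=> x y xs ys xy; split; apply: min => // yx; exact: xy.
apply: hyper_eq => //= x [y ys yx]; exact: selector_hyper (sK y ys) _ yx.
Qed.

(** * Topology of the hyperspace *)

Lemma nbhs_hyper_ind K (P : set (hyperspace U) -> Prop) :
  P setT -> (forall M N, M `<=` N -> P M -> P N) ->
  (forall M N, P M -> P N -> P (M `&` N)) ->
  (forall W, clopen W -> initial U W -> K `<=` W -> P (hplus W)) ->
  (forall V, clopen V -> final U V -> (K : set X) `&` V !=set0 -> P (hminus V)) ->
  forall N, nbhs K N -> P N.
Proof.
move=> PT PS PI Pplus Pminus N [B [[D' D'sub <-] [M D'M MK] BN]].
apply: (PS _ _ BN); apply: (PS M); first by move=> L ML; exists M.
have [D Dsub DM] := D'sub _ D'M; move: MK; rewrite -DM bigcap_fset.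
have {D'sub D'M DM}Dsub i : i \in enum_fset D -> hsubbase i by move=> /Dsub; rewrite inE.
elim: (enum_fset D) Dsub => [|A s IH] sub; first by rewrite big_nil.
rewrite big_cons => -[AK sK]; apply: PI; last first.
  by apply: IH => // i is_; apply: sub; rewrite inE is_ orbT.
have [[W [cW iW] WA]|[V [cV fV] VA]] := sub A (mem_head _ _).
  by rewrite /= -WA; apply: Pplus => //; move: AK; rewrite -WA.
by rewrite /= -VA; apply: Pminus => //; move: AK; rewrite -VA.
Qed.

Lemma open_hsubbase (M : set (hyperspace U)) : hsubbase M -> open M.
Proof.
move=> MS; exists [set M]; last by rewrite bigcup_set1.
by move=> _ ->; exact: finI_from1.
Qed.

Lemma open_hplus W : clopen W -> initial U W -> open (@hplus X U W).
Proof. by move=> cW iW; apply: open_hsubbase; left; exists W. Qed.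

Lemma open_hminus V : clopen V -> final U V -> open (@hminus X U V).
Proof. by move=> cV fV; apply: open_hsubbase; right; exists V. Qed.

Lemma setC_hplus W : ~` (@hplus X U W) = hminus (~` W).
Proof.
apply/seteqP; split=> [K KW|K [x [Kx nWx]] KW]; last exact: nWx (KW x Kx).
apply: contrapT => no; apply: KW => x Kx; apply: contrapT => nWx.
by apply: no; exists x.
Qed.

Lemma final_setC W : initial U W -> final U (~` W).
Proof. by move=> iW x y xy nWx Wy; apply: nWx; exact: iW xy Wy. Qed.

Lemma initial_setC V : final U V -> initial U (~` V).
Proof. by move=> fV x y xy nVy Vx; apply: nVy; exact: fV xy Vx. Qed.

Lemma clopen_hplus W : clopen W -> initial U W -> clopen (@hplus X U W).
Proof.
move=> cW iW; split; first exact: open_hplus.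
by rewrite -openC setC_hplus; apply: open_hminus; [exact: clopenC|exact: final_setC].
Qed.

(** If a point of [L] is outside [K], then [hplus K] is a clopen set that separates them. *)
Lemma hyper_hausdorff : hausdorff_space (hyperspace U).
Proof.
have sub K L : cluster (nbhs K) L -> L `<=` K.
  move=> cl; apply: contrapT => nLK.
  have [cK iK] := (hyper_clopen K, @hset_initial _ _ K).
  have [||M [/= MK]] := cl (hplus K) (~` hplus K).
  - by apply: open_nbhs_nbhs; split; [exact: open_hplus|].
  - apply: open_nbhs_nbhs; split; last exact: nLK.
    by apply: closed_openC; have [] := clopen_hplus cK iK.
  by apply.
move=> K L cl; apply: hyper_eq; last exact: sub.
apply: sub => A B LA KB; rewrite setIC; exact: cl KB LA.
Qed.

(** An ultrafilter converges to the intersection [K] of all clopen initial [W] such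
    that almost every element is contained in [W]: by compactness of [X], a clopen initial set containing [K] contains a finite intersection of such
    [W], hence almost every element. *)
Lemma hyper_space_compact : compact [set: hyperspace U].
Proof.
rewrite compact_ultra => F FU _.
pose K := [set x | forall W, clopen W -> initial U W -> F (hplus W) -> W x].
have Kc : closed K.
  move=> x clx W cW iW FW; have [_] := cW; apply; apply: closureS clx => y; exact.
have Ki : initial U K.
  by move=> x y xy Ky W cW iW FW; exact: iW xy (Ky W cW iW FW).
have KF W : clopen W -> initial U W -> K `<=` W -> F (hplus W).
  move=> cW iW KW.
  pose P A := exists V, [/\ clopen V, initial U V, F (hplus V) & A `&` V = set0].
  suff [V [_ _ FV WV]] : P (~` W).
    apply: filterS FV => L LV x /LV Vx; apply: contrapT => nWx.
    by have : (~` W `&` V) x by []; rewrite WV.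
  apply: compact_ind.
  - by apply: subclosed_compact X_compact _ => //; have [] := clopenC setT cW.
  - by exists setT; split; [exact: clopenT|by []|apply: filterS filterT|rewrite set0I].
  - move=> A B AB [V [cV iV FV BV]]; exists V; split=> //.
    by apply/seteqP; split=> // x [/AB Bx Vx]; rewrite -BV.
  - move=> A B [V [cV iV FV AV]] [V' [cV' iV' FV' BV']]; exists (V `&` V'); split.
    + exact: clopenI.
    + by move=> x y xy [Vy Vy']; split; [exact: iV xy Vy|exact: iV' xy Vy'].
    + by apply: filterS (filterI FV FV') => L [LV LV'] x Lx; split; [exact: LV|exact: LV'].
    + apply/seteqP; split=> // x [[Ax|Bx] [Vx Vx']]; first by rewrite -AV.
      by rewrite -BV'.
  - move=> x nWx; have /existsNP[V] : ~ K x by move=> /KW.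
    move=> /not_implyP[cV] /not_implyP[iV] /not_implyP[FV nVx].
    exists (~` V); first by apply: open_nbhs_nbhs; split=> //; have [] := clopenC setT cV.
    by exists V; split=> //; rewrite setICl.
have K0 : K !=set0.
  apply: contrapT => nK; have : F (@hplus X U set0).
    apply: KF; [exact: clopen0|by []|by move=> x Kx; apply: nK; exists x].
  by move=> /filter_ex[L L0]; have [x /L0] := hset_neq0 L.
exists (Hyperspace K0 Kc Ki); split=> // N.
apply: nbhs_hyper_ind => [|M M' MM' FM|M M' FM FM'|W cW iW KW|V cV fV [x [Kx Vx]]].
- exact: filterT.
- exact: filterS FM.
- exact: filterI.
- exact: KF.
have [//|FV] := in_ultra_setVsetC (hminus V) FU.
have : F (hplus (~` V)).
  by apply: filterS FV => L nLV y Ly Vy; apply: nLV; exists y.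
by move=> /(Kx _ (clopenC setT cV) (initial_setC fV)).
Qed.

End Hyperspace.

(** * Heights in the hyperspace *)

Section Rho.
Variables (X : topologicalType) (U : clopen_selector X).
Hypothesis X_compact : compact [set: X].
Hypothesis U_canonical : canonical_selector U.
Implicit Types (x y : X) (K L : hyperspace U).
Local Notation "x <=U y" := (sle U x y) (at level 70).
Local Notation h := (height [set: X]).

Definition maxpts K : {fset X} := projT1 (cid (hyper_Uset X_compact K)).

Lemma maxptsP K x : x \in maxpts K <-> maximal_in K x.
Proof.
rewrite /maxpts; case: cid => s /= [s0 [ac KE]]; rewrite [X in maximal_in X](KE).
exact: antichainP.
Qed.

Lemma maxpts_Uhyper s (s0 : s != fset0) : antichain U s -> maxpts (Uhyper U s0) = s.
Proof.
move=> ac; apply/fsetP => x; apply/idP/idP => [/maxptsP/(antichainP s0 ac)//|xs].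
exact/maxptsP/(antichainP s0 ac).
Qed.

Lemma maxpts_above K y : hset K y -> exists2 x, x \in maxpts K & y <=U x.
Proof.
rewrite /maxpts; case: cid => s /= [s0 [_ ->]] [x xs yx].
by exists x => //; exact/sleP.
Qed.

Lemma maxpts_anti K x y : x \in maxpts K -> y \in maxpts K -> x <=U y -> x = y.
Proof. by move=> /maxptsP[_ mx] /maxptsP[Ky _]; exact: mx. Qed.

Lemma maxpts_sub K x : x \in maxpts K -> hset K x.
Proof. by move=> /maxptsP[]. Qed.

Lemma height_lt x y : y <=U x -> y <> x -> h y <o h x.
Proof. by move=> /sleP; exact: height_canonical_lt. Qed.

Definition rho K : ord := \big[nsum/ozero]_(x <- maxpts K) wt (h x).

Lemma rho_Uhyper s (s0 : s != fset0) : antichain U s ->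
  rho (Uhyper U s0) = \big[nsum/ozero]_(x <- s) wt (h x).
Proof. by move=> ac; rewrite /rho maxpts_Uhyper. Qed.

Lemma rho_principal x : rho (principal U x) =o wt (h x).
Proof.
have ac : antichain U [fset x]%fset by move=> y z /[!inE] /eqP-> /eqP->.
have x0 : [fset x]%fset != fset0 by apply/fset0Pn; exists x; rewrite inE.
have -> : principal U x = Uhyper U x0.
  apply: hyper_eq => y /=; first by move=> xy; exists x => //=; rewrite inE.
  by move=> [z /=]; rewrite inE => /eqP->.
have xE : perm_eq [fset x]%fset [:: x].
  by apply: uniq_perm => // y; rewrite !inE.
by rewrite (rho_Uhyper x0 ac) (perm_big_nsum _ xE) big_cons big_nil; exact: nsum0.
Qed.

Section Lists.
Implicit Types (s t : seq X).
Local Notation chainfree t := {in t &, forall x y, x <=U y -> x = y}.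

Lemma wt_below_lt x t : ozero <o h x -> x \notin t -> (forall y, y \in t -> y <=U x) ->
  \big[nsum/ozero]_(y <- t) wt (h y) <o wt (h x).
Proof.
move=> hx xt tx; apply: big_nsum_lt; [exact: nclosed_wt|exact: wt_gt0|].
move=> y yt; apply: wt_lt; apply: height_lt; first exact: tx.
by move=> yx; move: xt; rewrite -yx yt.
Qed.

Lemma wt_below_le x t : uniq t -> chainfree t -> (forall y, y \in t -> y <=U x) ->
  \big[nsum/ozero]_(y <- t) wt (h y) <=o wt (h x).
Proof.
move=> ut ct tx; have [xt|xt] := boolP (x \in t).
  have tE : perm_eq t [:: x].
    apply: uniq_perm => // y; rewrite inE; apply/idP/eqP => [yt|->//].
    by apply: ct => //; exact: tx.
  by rewrite (perm_big_nsum _ tE) big_cons big_nil nsum0; exact: ole_refl.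
have [hx|/oposP hx] := pselect (h x =o ozero); last exact/oltW/wt_below_lt.
case: t tx xt {ut ct} => [|y t] tx xt; first by rewrite big_nil; exact: ole0.
exfalso; have : h y <o h x.
  apply: height_lt; first by apply: tx; exact: mem_head.
  by move=> yx; move: xt; rewrite yx mem_head.
by rewrite hx => /olt0.
Qed.

(** Points of [t] are grouped according to a point of [s] above them.  Those below
    [x] contribute at most the weight of [x]: either there is only [x] itself, or all
    of them are lower than [x] and closure of the weight of [x] applies. *)
Lemma wt_cover_le s t : uniq t -> chainfree t ->
  (forall y, y \in t -> exists2 x, x \in s & y <=U x) ->
  \big[nsum/ozero]_(y <- t) wt (h y) <=o \big[nsum/ozero]_(x <- s) wt (h x).
Proof.
elim: s t => [|x s IH] t ut ct ts.
  case: t ts {ut ct} => [|y t] ts; first by rewrite !big_nil; exact: ole0.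
  by have [] := ts y (mem_head _ _).
rewrite big_cons (big_nsum_filter _ _ (fun y => `[< y <=U x >])).
apply: nsum_le; [apply: wt_below_le|apply: IH].
- exact: filter_uniq.
- by move=> y z; rewrite !mem_filter => /andP[_ yt] /andP[_ zt]; exact: ct.
- by move=> y; rewrite mem_filter => /andP[/asboolP].
- exact: filter_uniq.
- by move=> y z; rewrite !mem_filter => /andP[_ yt] /andP[_ zt]; exact: ct.
- move=> y; rewrite mem_filter => /andP[/asboolPn nyx yt].
  by have [z] := ts y yt; rewrite inE => /orP[/eqP->//|zs yz]; exists z.
Qed.
End Lists.

(** Elements contained in [K] would not do: two isolated points of [X] give three
    isolated elements of the hyperspace, with no end point among them.  Requiring the
    maximal points of height 0 of [K] to be kept makes [K] the only element of largest
    height, since dropping any other maximal point lowers the natural sum. *)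
Definition hsel K : set (hyperspace U) :=
  [set L : hyperspace U | L `<=` K /\ forall x, x \in maxpts K -> h x =o ozero -> hset L x].

(** Some maximal point [x] of [K], of positive height, is missing from [L].  The
    maximal points of [L] below [x] have a smaller total weight than [x], and the other
    ones are covered by the remaining maximal points of [K]. *)
Lemma rho_lt K L : hsel K L -> L <> K -> rho L <o rho K.
Proof.
move=> [LK iL] neq.
have [x xK nLx] : exists2 x, x \in maxpts K & ~ hset L x.
  apply: contrapT => no; apply: neq; apply: hyper_eq => // y /maxpts_above[x xK /sleP yx].
  apply: selector_hyper yx; apply: contrapT => nLx; by apply: no; exists x.
have hx : ozero <o h x by apply: oposP => hx; apply: nLx; exact: iL.
rewrite /rho (perm_big_nsum _ (perm_to_rem xK)) big_cons.
rewrite (big_nsum_filter _ _ (fun y => `[< y <=U x >])).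
apply: nsum_lt_le; [apply: wt_below_lt => //|apply: wt_cover_le].
- by rewrite mem_filter negb_and; apply/orP; right; apply/negP => /maxpts_sub.
- by move=> y; rewrite mem_filter => /andP[/asboolP].
- exact/filter_uniq/fset_uniq.
- by move=> y z; rewrite !mem_filter => /andP[_ yt] /andP[_ zt]; exact: maxpts_anti yt zt.
- move=> y; rewrite mem_filter => /andP[/asboolPn nyx /maxpts_sub/LK/maxpts_above[z zK yz]].
  exists z => //; rewrite mem_rem_uniq ?fset_uniq // inE zK andbT.
  by apply/eqP => zx; apply: nyx; rewrite -zx.
Qed.

Lemma selector_isolated x y : h x =o ozero -> U x y -> y = x.
Proof.
move=> hx xy; apply: contrapT => yx.
by have := height_canonical_lt U_canonical xy yx; rewrite hx => /olt0.
Qed.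

(** Points of height 0 are isolated and form a selector set by themselves; if [x] is
    such a point, maximal in [K], then removing it from [K] leaves a clopen initial
    set, and keeping it is the complementary condition. *)
Lemma hsel_clopen K : clopen (hsel K).
Proof.
pose s := [fset x in maxpts K | `[< h x =o ozero >]]%fset.
pose W x := hset K `&` ~` U x.
have sP x : x \in s <-> x \in maxpts K /\ h x =o ozero.
  by rewrite !inE /=; split=> [/andP[? /asboolP]|[-> /asboolP]].
have Wc x : clopen (W x).
  by apply: clopenI; [exact: hyper_clopen|apply: (clopenC setT); exact: selector_clopen].
have Wi x : x \in s -> initial U (W x).
  move=> /sP[/maxptsP[_ mx] hx] y z yz [Kz nxz]; split; first exact: hset_initial yz Kz.
  move=> /(selector_isolated hx) yx; apply: nxz; rewrite yx in yz.
  by rewrite (mx z Kz yz); exact: selector_refl.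
have -> : hsel K = hplus K `&` \bigcap_(x in [set` s]) ~` hplus (W x).
  apply/seteqP; split=> [L [LK iL]|L [LK iL]]; split=> //.
    move=> x /sP[xK hx] LW; have [_] := LW x (iL x xK hx).
    by apply; exact: selector_refl.
  move=> x xK hx; apply: contrapT => nLx; apply: (iL x); first exact/sP.
  move=> y Ly; split; first exact: LK.
  by move=> /(selector_isolated hx) yx; apply: nLx; rewrite -yx.
apply: clopenI.
  by apply: clopen_hplus; [exact: hyper_clopen|exact: hset_initial].
rewrite bigcap_fset big_seq; apply: big_ind => [|A B|x xs]; [exact: clopenT|exact: clopenI|].
by apply: (clopenC setT); apply: clopen_hplus => //; exact: Wi.
Qed.

Lemma hsel_refl K : hsel K K.
Proof. by split=> // x /maxpts_sub. Qed.

Lemma hsel_anti K L : K <> L -> ~ hsel L K \/ ~ hsel K L.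
Proof.
move=> neq; have [[KL _]|] := pselect (hsel L K); last by left.
by right=> -[LK _]; apply: neq; exact: hyper_eq.
Qed.

Lemma hsel_sub K L : hsel K L -> hsel L `<=` hsel K.
Proof.
move=> [LK iL] M [ML iM]; split; first exact: subset_trans LK.
move=> x xK hx; apply: iM => //; have /maxptsP[_ mx] := xK.
by apply/maxptsP; split=> [|y /LK]; [exact: iL|exact: mx].
Qed.

Definition hselector : clopen_selector (hyperspace U) :=
  ClopenSelector hsel_clopen hsel_refl hsel_anti hsel_sub.

(** Elements of the subbase only constrain a maximal point [x] through open
    neighborhoods of it: if a clopen final set meets [K], it contains a maximal point
    of [K]. *)
Lemma nbhs_maxpts K x N : x \in maxpts K -> nbhs K N -> exists2 O, nbhs x O &
  forall L, L `<=` K -> (forall z, z \in maxpts K -> z <> x -> hset L z) ->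
    (exists2 y, O y & hset L y) -> N L.
Proof.
move=> xK; move: N; apply: nbhs_hyper_ind.
- by exists setT => //; exact: filterT.
- move=> M N MN [O xO OM]; exists O => // L LK Lz LO; apply: MN; exact: OM.
- move=> M N [O xO OM] [O' xO' ON]; exists (O `&` O'); first exact: filterI.
  move=> L LK Lz [y [Oy O'y] Ly].
  by split; [apply: OM|apply: ON] => //; exists y.
- move=> W cW iW KW; exists setT; first exact: filterT.
  by move=> L LK _ _; exact: subset_trans KW.
- move=> V [oV _] fV [w [/maxpts_above[z zK wz] Vw]]; have Vz := fV _ _ wz Vw.
  have [zx|zx] := pselect (z = x).
    exists V; first by apply: open_nbhs_nbhs; split=> //; rewrite -zx.
    by move=> L LK _ [y Vy Ly]; exists y.
  exists setT; first exact: filterT.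
  by move=> L LK Lz _; exists z; split=> //; exact: Lz.
Qed.

(** Once [y] has been picked, the others are taken outside [U y]: its complement is
    still a neighborhood of [x], and they differ from [y]. *)
Lemma many_points x e n O : e <o h x -> nbhs x O -> exists t : seq X,
  [/\ uniq t, size t = n & forall y, y \in t -> [/\ O y, y <> x & h y =o e]].
Proof.
move=> ex; elim: n O => [|n IH] O xO; first by exists [::].
have [|y [[Oy xy] yx hy]] := rank_eq (N := O `&` U x) (is_rank_height U_canonical) ex.
  by apply: filterI => //; exact: selector_nbhs.
have [|t [ut st tP]] := IH (O `&` ~` U y).
  apply: filterI => //; apply: open_nbhs_nbhs; split.
    by have [] := clopenC setT (selector_clopen U y).
  by move=> yx'; apply: yx; apply: (@sle_anti _ U); exact/sleP.
exists (y :: t); split=> /=; first last.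
- move=> z; rewrite inE => /orP[/eqP->|zt]; first by split.
  by have [[Oz _] zx hz] := tP z zt.
- by rewrite st.
- rewrite ut andbT; apply/negP => /tP[[_ nyy] _ _]; apply: nyy; exact: selector_refl.
Qed.

(** Below the natural sum [rho K], some term, the weight of a maximal point [x], can be
    replaced by [n] times the weight of some [e] smaller than the height of [x].  Replacing
    [x] by points of height exactly [e], close to [x] and outside the sets [U z] of the
    other maximal points [z], gives an element that is close to [K]. *)
Lemma rho_cof K b N : b <o rho K -> nbhs K N -> exists L, [/\ N L, L <> K & b <=o rho L].
Proof.
move=> /olt_big_nsum[x [xK [d /olt_wt[e [n [ex dn]]] bd]]] KN.
pose s := (maxpts K `\ x)%fset.
have sP z : z \in s <-> z \in maxpts K /\ z <> x.
  by rewrite !inE; split=> [/andP[/eqP]|[-> /eqP->]].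
have {bd dn}bs : b <=o nsum (nmul (wt e) n.+1) (\big[nsum/ozero]_(y <- s) wt (h y)).
  apply: ole_trans bd _; apply: nsum_le.
    by apply: ole_trans dn _; apply: nmul_le => //; exact: ole_refl.
  have rs : perm_eq (rem x (maxpts K)) s.
    apply: uniq_perm; [exact/rem_uniq/fset_uniq|exact: fset_uniq|move=> y].
    by rewrite mem_rem_uniq ?fset_uniq // !inE.
  by rewrite (perm_big_nsum _ rs); exact: ole_refl.
have [O xO ON] := nbhs_maxpts xK KN.
(* [n.+1] rather than [n] points, so that there is at least one near [x] *)
have [|t [ut st tP]] := many_points n.+1 (O := O `&` (U x `&` ~` Uset U s)) ex.
  apply: filterI => //; apply: filterI; first exact: selector_nbhs.
  apply: open_nbhs_nbhs; split; first exact/closed_openC/Uset_closed.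
  move=> [z /= /sP[zK zx] /sleP xz]; apply: zx.
  by symmetry; exact: maxpts_anti xK zK xz.
have {tP} : forall y, y \in t -> [/\ O y, y <=U x, y <> x, ~ Uset U s y & h y =o e].
  by move=> y /tP[[Oy [/sleP xy nsy]] yx hy].
move=> tP; pose r := [fset y in t ++ s]%fset.
have rP y : y \in r = (y \in t) || (y \in s) by rewrite !inE.
have ac : antichain U r.
  suff ac y z : y \in r -> z \in r -> y <=U z -> y = z.
    by move=> y z yr zr yz; split=> [/(ac _ _ yr zr)|/(ac _ _ zr yr)/esym].
  rewrite !rP => /orP[yt|ys] /orP[zt|zs] yz.
  - apply: contrapT => neq; have := height_lt yz neq.
    have [_ _ _ _ ->] := tP y yt; have [_ _ _ _ ->] := tP z zt.
    exact: olt_irrefl.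
  - by have [_ _ _ nsy _] := tP y yt; case: nsy; exists z => //; exact/sleP.
  - have /sP[yK []] := ys; apply: maxpts_anti yK xK _.
    by have [_ zx _ _ _] := tP z zt; exact: sle_trans yz zx.
  - have /sP[yK _] := ys; have /sP[zK _] := zs; exact: maxpts_anti yK zK yz.
have [y0 y0t] : exists y0, y0 \in t by case: t st {ut tP r rP ac} => // y0 t _; exists y0; exact: mem_head.
have r0 : r != fset0 by apply/fset0Pn; exists y0; rewrite rP y0t.
have ts : perm_eq (t ++ s) r.
  apply: uniq_perm; [|exact: fset_uniq|by move=> y; rewrite rP mem_cat].
  rewrite cat_uniq ut fset_uniq andbT /=; apply/hasPn => y ys; apply/negP => /tP[_ _ _].
  by case; exists y => //; exact: selector_refl.
exists (Uhyper U r0); split.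
- apply: ON.
  + move=> z [y /=]; rewrite rP => /orP[/tP[_ yx _ _ _]|/sP[yK _]] yz.
      by apply: selector_hyper (maxpts_sub xK) _ _; apply/sleP; apply: sle_trans yx; exact/sleP.
    exact: selector_hyper (maxpts_sub yK) _ yz.
  + move=> z zK zx; exists z; last exact: selector_refl.
    by rewrite /= rP; apply/orP; right; apply/sP.
  + exists y0; first by have [] := tP y0 y0t.
    by exists y0; [rewrite /= rP y0t|exact: selector_refl].
- move=> LK; have : hset (Uhyper U r0) x by rewrite LK; exact: maxpts_sub.
  move=> [y /=]; rewrite rP => /orP[yt|/sP[yK yx]] /sleP xy.
    have [_ yx neq _ _] := tP y yt; exact: neq (sle_anti yx xy).
  by apply: yx; symmetry; exact: maxpts_anti xK yK xy.
- rewrite (rho_Uhyper r0 ac) -(perm_big_nsum _ ts) big_nsum_cat.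
  rewrite (@big_nsum_const _ t _ (wt e)) ?st // => y /tP[_ _ _ _ ->]; reflexivity.
Qed.

Lemma is_rank_rho : is_rank rho.
Proof.
split; last exact: rho_cof.
move=> K; exists (hsel K) => [|L KL]; last exact: rho_lt.
exact: open_nbhs_nbhs (conj (hsel_clopen K).1 (hsel_refl K)).
Qed.

Lemma height_rho K : height [set: hyperspace U] K =o rho K.
Proof. exact: height_rank is_rank_rho openT _. Qed.

Lemma hselector_canonical : canonical_selector hselector.
Proof.
move=> K; apply: unitary_rank is_rank_rho _ (hsel_refl K) _; first exact: (hsel_clopen K).1.
exact: rho_lt.
Qed.
End Rho.

Unset Implicit Arguments.
Theorem theorem4 (X : topologicalType) (U : clopen_selector X)
    (X_compact : compact [set: X]) (X_hausdorff : hausdorff_space X)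
    (U_canonical : canonical_selector U) :
  [/\ canonical_Skula (hyperspace U),
      (forall K : hyperspace U, exists (s : {fset X}) (s0 : s != fset0),
        antichain U s /\ K = Uhyper U s0),
      (forall (s : {fset X}) (s0 : s != fset0), antichain U s ->
        height [set: hyperspace U] (Uhyper U s0) =o
          \big[hsum/ozero]_(x <- s) height [set: hyperspace U] (principal U x)) &
      (forall x : X,
        [/\ height [set: X] x =o ozero ->
              height [set: hyperspace U] (principal U x) =o ozero,
            height [set: X] x =o oone ->
              height [set: hyperspace U] (principal U x) =o oone &
            (forall a : ord,
              height [set: X] x =o oadd oone a -> onat 2 <=o height [set: X] x ->
              height [set: hyperspace U] (principal U x) =o oexpw a)])].
Proof.
have hp x : height [set: hyperspace U] (principal U x) =o wt (height [set: X] x).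
  by rewrite (height_rho X_compact U_canonical); exact: rho_principal.
split.
- split; [exact: hyper_space_compact|exact: hyper_hausdorff|].
  exists (hselector X_compact U_canonical); exact: hselector_canonical.
- exact: hyper_Uset.
- move=> s s0 ac; rewrite (height_rho X_compact U_canonical) (rho_Uhyper X_compact s0 ac).
  by symmetry; apply: eq_big_hsum => x _.
- move=> x; split=> [h0|h1|a ha _]; rewrite hp.
  + by rewrite h0; exact: wt0.
  + have -> : height [set: X] x =o oadd oone ozero by rewrite oadd0.
    rewrite wt_oexpw; apply: oeq_ltP => c; rewrite olt_oexpw olt_oone.
    by split=> [[c0|[d /olt0]]|c0] //; left.
  + by rewrite ha; exact: wt_oexpw.
Qed.
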